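(* Let $X$, $Y$, $V$ be Banach spaces, let $\Omega \subseteq X$ and $\hat\Omega \subseteq Y$ be open sets, and let $\phi : \Omega \to \hat\Omega$ and $f : \hat\Omega \to V$ be mappings. Let $m \geq 1$ be an integer. If $x \in \Omega$ is such that $\phi$ is $m$-times (Fréchet) differentiable at $x$ and $f$ is $m$-times (Fréchet) differentiable at $\phi(x)$, then $f \circ \phi$ is $m$-times differentiable at $x$ and, for all $v_1, v_2, \ldots, v_m \in X$, $$\nabla^{m}(f\circ\phi)_{|x}(v_1,\ldots,v_m) = \sum_{k=1}^{m}\ \sum_{\{P_1,\ldots,P_k\} \in \mathcal{P}(m,k)} \nabla^{k} f_{|\phi(x)}\Big( \nabla^{|P_1|}\phi_{|x}\big(\textstyle\bigvee_{i\in P_1} v_i\big), \nabla^{|P_2|}\phi_{|x}\big(\bigvee_{i\in P_2} v_i\big), \ldots, \nabla^{|P_k|}\phi_{|x}\big(\bigvee_{i\in P_k} v_i\big)\Big).$$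
   Context: Differentiability is Fréchet differentiability; the $m$-th derivative is defined recursively, and $\nabla^m g_{|x}$ denotes the $m$-th derivative of $g$ at $x$, viewed as a bounded symmetric $m$-linear map. $\mathcal{P}(m,k)$ is the set of all (unordered) partitions $\{P_1,\ldots,P_k\}$ of $\{1,\ldots,m\}$ into $k$ pairwise disjoint non-empty sets. For a finite set $P \subseteq \{1,\ldots,m\}$, $\bigvee_{i \in P} v_i$ denotes the symmetric tensor product of the vectors $v_i$, $i\in P$, and $\nabla^{|P|}\phi_{|x}(\bigvee_{i\in P} v_i)$ is the value of the symmetric $|P|$-linear map $\nabla^{|P|}\phi_{|x}$ on the vectors $v_i$, $i\in P$, in any order. *)

(* Defs.v *)
From HB Require Import structures.
From mathcomp Require Import all_boot all_order all_algebra.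
From mathcomp Require Import complex.
From mathcomp Require Import all_classical all_reals all_analysis.

Set Implicit Arguments.
Unset Strict Implicit.
Unset Printing Implicit Defensive.

Import Order.TTheory GRing.Theory Num.Theory.
Import numFieldNormedType.Exports.

Local Open Scope classical_set_scope.
Local Open Scope ring_scope.

Variant scalar_kind := RealScalars | ComplexScalars.

Definition scalars (R : realType) (k : scalar_kind) : numFieldType :=
  match k with
  | RealScalars => R
  | ComplexScalars => R[i]
  end.

(* The norm of a normed module over K takes its values in K itself.  Least
   upper bounds exist in R only, so norms are moved back and forth between K
   and R: [of_real] is the embedding of R and [re_part] the real part. *)
Section RealPart.
Variables (R : realType) (k : scalar_kind).
Local Notation K := (scalars R k).

Definition of_real : R -> K :=
  match k return R -> scalars R k with
  | RealScalars => id
  | ComplexScalars => fun r => r%:C%C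
  end.

Definition re_part : K -> R :=
  match k return scalars R k -> R with
  | RealScalars => id
  | ComplexScalars => fun z => complex.Re z
  end.

Lemma of_realK : cancel of_real re_part.
Proof. by rewrite /of_real /re_part; case: k. Qed.

Lemma of_real0 : of_real 0 = 0.
Proof. by rewrite /of_real; case: k. Qed.

Lemma of_realD r s : of_real (r + s) = of_real r + of_real s.
Proof. by rewrite /of_real; case: k => //=; rewrite rmorphD. Qed.

Lemma of_realM r s : of_real (r * s) = of_real r * of_real s.
Proof. by rewrite /of_real; case: k => //=; rewrite rmorphM. Qed.

Lemma ler_of_real r s : (of_real r <= of_real s) = (r <= s).
Proof. by rewrite /of_real; case: k => //=; rewrite lecR. Qed.

Lemma re_partK (z : K) : 0 <= z -> of_real (re_part z) = z.
Proof.
rewrite /of_real /re_part; move: z; case: k => [z //|z].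
by case: z => a b; rewrite [_ <= _]lecE => /andP[/eqP/= -> _].
Qed.

Lemma re_part_ge0 (z : K) : 0 <= z -> 0 <= re_part z.
Proof. by move=> z0; rewrite -ler_of_real re_partK// of_real0. Qed.

Lemma ler_re_part (z w : K) : 0 <= z -> 0 <= w ->
  (re_part z <= re_part w) = (z <= w).
Proof. by move=> z0 w0; rewrite -ler_of_real !re_partK. Qed.

End RealPart.

(* Bounded (= continuous) linear maps, with the operator norm. *)
Section BoundedLinear.
Variables (R : realType) (k : scalar_kind).
Local Notation K := (scalars R k).
Variables X W : normedModType K.

Definition bounded_linear : {pred X -> W} :=
  mem [set f : X -> W | linear f /\ continuous f].

Record blin := Blin {
  blin_fun :> X -> W ;
  blinP : blin_fun \in bounded_linear
}.

HB.instance Definition _ := [isSub for blin_fun].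
HB.instance Definition _ := [Choice of blin by <:].

Lemma bounded_linear_submod_closed : submod_closed bounded_linear.
Proof.
split.
  apply/mem_set; split=> [a u v|x]; last exact: cst_continuous.
  by rewrite /= scaler0 addr0.
move=> a f g /set_mem[lf cf] /set_mem[lg cg]; apply/mem_set; split.
  move=> b u v /=.
  rewrite -![(_ + _ : X -> W) _]/(_ + _) -![(a *: f) _]/(a *: f _).
  rewrite lf lg !scalerDr !scalerA [b * a]mulrC -!addrA; congr (_ + _).
  by rewrite addrCA.
move=> x; rewrite /continuous_at.
by apply: (cvgD (f := a *: f)); [apply: cvgZl_tmp; exact: cf|exact: cg].
Qed.

HB.instance Definition _ :=
  GRing.isSubmodClosed.Build K (X -> W) bounded_linear
    bounded_linear_submod_closed.
HB.instance Definition _ := [SubChoice_isSubLmodule of blin by <:].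


Definition opnorm (f : blin) : K :=
  of_real k (sup [set re_part `|f x| | x in [set x : X | `|x| <= 1]]).

Lemma blin_linear (f : blin) : linear f.
Proof. by case: (set_mem (blinP f)). Qed.

Lemma blin_continuous (f : blin) : continuous f.
Proof. by case: (set_mem (blinP f)). Qed.

HB.instance Definition _ (f : blin) :=
  GRing.isLinear.Build K X W *:%R f (blin_linear f).

Lemma opnorm_has_sup (f : blin) :
  has_sup [set re_part `|f x| | x in [set x : X | `|x| <= 1]].
Proof.
split; first by exists (re_part `|f 0|), 0 => //=; rewrite normr0.
have := @continuous_linear_bounded K X W 0 f (@blin_continuous f 0).
move=> /linear_boundedP/pinfty_ex_gt0[M M0 Mf].
exists (re_part M) => _ [x /= x1 <-].
rewrite ler_re_part ?(ltW M0)//; apply: le_trans (Mf x) _.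
by rewrite ler_piMr// ltW.
Qed.

Lemma opnorm_ge0 (f : blin) : 0 <= opnorm f.
Proof.
rewrite -(of_real0 R k) ler_of_real.
apply: le_trans (re_part_ge0 (normr_ge0 (f 0))) _.
by apply: (sup_upper_bound (opnorm_has_sup f)); exists 0; rewrite //= normr0.
Qed.

Lemma opnorm_le_bound (f : blin) (M : K) :
  0 <= M -> (forall x, `|x| <= 1 -> `|f x| <= M) -> opnorm f <= M.
Proof.
move=> M0 Mf; rewrite -[leRHS](re_partK M0) ler_of_real.
apply: ge_sup; first by case: (opnorm_has_sup f).
by move=> _ [x /= x1 <-]; rewrite ler_re_part// Mf.
Qed.

Lemma ler_opnorm (f : blin) (x : X) : `|f x| <= opnorm f * `|x|.
Proof.
have [->|x0] := eqVneq x 0; first by rewrite linear0 !normr0 mulr0.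
have nx0 : 0 < `|x| by rewrite normr_gt0.
have -> : `|f x| = `|f (`|x|^-1 *: x)| * `|x|.
  by rewrite linearZ/= normrZ normfV normr_id mulrAC mulVf ?mul1r ?gt_eqF.
rewrite ler_pM2r// -[leLHS](re_partK (normr_ge0 _)) ler_of_real.
apply: (sup_upper_bound (opnorm_has_sup f)); exists (`|x|^-1 *: x) => //=.
by rewrite normrZ normfV normr_id mulVf ?gt_eqF.
Qed.

Lemma opnormD (f g : blin) : opnorm (f + g) <= opnorm f + opnorm g.
Proof.
apply: opnorm_le_bound => [|x x1]; first by rewrite addr_ge0 ?opnorm_ge0.
rewrite (le_trans (ler_normD _ _))// lerD// (le_trans (ler_opnorm _ _))//.
  by rewrite ler_piMr ?opnorm_ge0.
by rewrite ler_piMr ?opnorm_ge0.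
Qed.

Lemma opnormZ (a : K) (f : blin) : opnorm (a *: f) = `|a| * opnorm f.
Proof.
have leZ b (g : blin) : opnorm (b *: g) <= `|b| * opnorm g.
  apply: opnorm_le_bound => [|x x1]; first by rewrite mulr_ge0 ?opnorm_ge0.
  rewrite [`|_|]normrZ ler_wpM2l// (le_trans (ler_opnorm _ _))//.
  by rewrite ler_piMr ?opnorm_ge0.
apply/le_anti; rewrite leZ/=.
have [->|a0] := eqVneq a 0; first by rewrite normr0 mul0r opnorm_ge0.
rewrite -ler_pdivlMl ?normr_gt0// -normfV.
by rewrite -[X in opnorm X <= _](scalerK a0).
Qed.

Lemma opnorm0_eq0 (f : blin) : opnorm f = 0 -> f = 0.
Proof.
move=> f0; apply/val_inj/funext => x /=.
by apply/eqP; rewrite -normr_le0 (le_trans (ler_opnorm _ _))// f0 mul0r.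
Qed.

HB.instance Definition _ :=
  Lmodule_isNormed.Build K blin opnormD opnormZ opnorm0_eq0.

End BoundedLinear.

Section IteratedDerivative.
Variables (R : realType) (k : scalar_kind).
Local Notation K := (scalars R k).
Variables X W : normedModType K.

(* L(X, L(X, ... L(X, W))), isometric to the space of bounded n-linear maps
   from X to W. *)
Fixpoint multilin (n : nat) : normedModType K :=
  if n is n'.+1 then blin X (multilin n') else W.

(* A(v_1, ..., v_n) for a list of vectors of size n. *)
Fixpoint meval (n : nat) : multilin n -> seq X -> W :=
  match n return multilin n -> seq X -> W with
  | 0 => fun A _ => A
  | n'.+1 => fun A s => meval (A (head 0 s)) (behead s)
  end.

(* The differential of h at x as a point of L(X, Z).  Where h is differentiable,
   'd h x is bounded linear, so the default value 0 of insubd is not used (see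
   deriv_blinE); elsewhere the value is meaningless. *)
Definition deriv_blin (Z : normedModType K) (h : X -> Z) (x : X) : blin X Z :=
  insubd (0 : blin X Z) ('d h x : X -> Z).

Lemma deriv_blinE (Z : normedModType K) (h : X -> Z) (x : X) :
  differentiable h x -> deriv_blin h x = 'd h x :> (X -> Z).
Proof.
move=> dh; rewrite /deriv_blin; apply: insubdK; apply/mem_set; split.
  exact: linearP.
exact: diff_continuous.
Qed.

Fixpoint nderiv (n : nat) (g : X -> W) : X -> multilin n :=
  match n return X -> multilin n with
  | 0 => g
  | n'.+1 => deriv_blin (nderiv n' g)
  end.

Fixpoint ndifferentiable (n : nat) (g : X -> W) (x : X) : Prop :=
  if n is n'.+1 then
    (\forall y \near x, ndifferentiable n' g y) /\
    differentiable (nderiv n' g) x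
  else True.

End IteratedDerivative.

(* A choice, for every finite set, of an order in which to list its elements. *)
Definition is_listing (T : finType) (s : {set T} -> seq T) : Prop :=
  forall A : {set T}, perm_eq (s A) (enum A).

(* P(m, j): the partitions of an m-element set into j nonempty blocks. *)
Definition set_partitions (m j : nat) : {set {set {set 'I_m}}} :=
  [set Q | finset.partition Q [set: 'I_m] & #|Q| == j]%SET.

(* Main.v *)
From HB Require Import structures.
Require Import Defs.
From mathcomp Require Import all_boot all_order all_algebra.
From mathcomp Require Import all_classical all_reals all_analysis.

Set Implicit Arguments.
Unset Strict Implicit.
Unset Printing Implicit Defensive.

Import Order.TTheory GRing.Theory Num.Theory.
Import numFieldNormedType.Exports.

Local Open Scope classical_set_scope.
Local Open Scope ring_scope.

(** Put [mderiv g x [:: v_1; ...; v_n]] for the n-th derivative of [g] at [x]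
applied to the list of vectors v_1, ..., v_n; the first vector of the list is
the direction of the last differentiation.  The proof has three
ingredients.

Existence ([ndifferentiable_comp]).  The first derivative of f o phi is
y |-> Df(phi y) o Dphi(y), a bounded bilinear map applied to (Df) o phi and
Dphi.  By induction on n the composite (Df) o phi is n times differentiable,
and bounded bilinear maps preserve n-fold differentiability (Leibniz,
[ndifferentiable_bilinear]).  This argument splits off the derivative that is
taken first, whereas the iterated derivative is defined by splitting off the one
taken last; [nderivSr] and [ndifferentiableSr] pass between the two orders of
currying.  The spaces in which these functions take their values
change along the induction, so bilinear maps are handled uniformly as elements
of L(E, L(F, G)).

Symmetry ([mderiv_perm]).  The second derivative is symmetric as soon as the
first one is differentiable at the point ([second_derivative_sym]): both
D^2 g(x)(u, v) and D^2 g(x)(v, u) are approximated, up to o((|u| + |v|)^2), by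
the same second difference of g, thanks to the mean value inequality.
Transposing the two outermost directions in this way, and differentiating the
symmetry of the lower derivatives, gives invariance under every permutation.

The formula ([mderiv_comp]).  It is proved for an arbitrary duplicate-free list
of directions, by induction on the list.  Prepending a direction a
differentiates the formula for the tail, which holds in a neighbourhood.  By
the chain rule and multilinearity, the term of a partition Q splits into one
term where the derivative falls on D^k f, which creates the new block {a}, and
one term for each block P of Q, where it falls on D^|P| phi and a joins P.  Each
partition of the enlarged set arises exactly once in this manner
([big_partitionU1]), and the symmetry of the derivatives makes the order in
which blocks and directions are listed irrelevant. *)

(** * Bounded linear and bilinear maps, and their derivatives *)

Section BoundedOperators.
Variables (R : realType) (k : scalar_kind).
Local Notation K := (scalars R k).

Lemma blin_ext (E F : normedModType K) (S T : blin E F) :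
  (forall x, S x = T x) -> S = T.
Proof. by move=> ST; apply/val_inj/funext. Qed.

Lemma ler_opnormr (E F : normedModType K) (T : blin E F) x :
  `|T x| <= `|T| * `|x|.
Proof. exact: ler_opnorm. Qed.

Lemma blin_addE (E F : normedModType K) (S T : blin E F) x :
  (S + T) x = S x + T x.
Proof. by []. Qed.

Lemma blin_scaleE (E F : normedModType K) a (T : blin E F) x :
  (a *: T) x = a *: T x.
Proof. by []. Qed.

Lemma blin_normr_le (E F : normedModType K) (T : blin E F) (M : K) : 0 <= M ->
  (forall x, `|T x| <= M * `|x|) -> `|T| <= M.
Proof.
move=> M0 TM; apply: opnorm_le_bound => // x x1.
by apply: le_trans (TM x) _; rewrite ler_piMr.
Qed.

Lemma blin_of_bounded (E F : normedModType K) (f : E -> F) (M : K) :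
  linear f -> 0 <= M -> (forall x, `|f x| <= M * `|x|) ->
  {T : blin E F | forall x, T x = f x}.
Proof.
move=> lf M0 fM.
suff fbl : f \in bounded_linear (X:=E) (W:=F) by exists (Blin fbl).
apply/mem_set; split=> //.
pose g : {linear E -> F} := HB.pack f (GRing.isLinear.Build _ _ _ _ f lf).
apply: (@linear_bounded_continuous K E F g).1.
apply/linear_boundedP.
near=> r => x; apply: le_trans (fM x) _; apply: ler_wpM2r => //.
by near: r; apply: nbhs_pinfty_ge; rewrite ger0_real.
Unshelve. all: by end_near.
Qed.

(** The way bilinear maps are produced below: L(E, L(F, G)) stands for the space
of bounded bilinear maps, which turns partial application and composition of
bilinear maps into ordinary operations on bounded operators. *)
Lemma bilinear_of_bounded (E F G : normedModType K) (f : E -> F -> G) (M : K) :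
  (forall u, linear (f u)) -> (forall v, linear (f^~ v)) -> 0 <= M ->
  (forall u v, `|f u v| <= M * `|u| * `|v|) ->
  {B : blin E (blin F G) | forall u v, B u v = f u v}.
Proof.
move=> lr ll M0 fM.
have Mu (u : E) : 0 <= M * `|u| by rewrite mulr_ge0.
pose g u := sval (blin_of_bounded (lr u) (Mu u) (fM u)).
have gE u v : g u v = f u v by rewrite /g; case: blin_of_bounded.
have lg : linear g.
  by move=> a u v; apply: blin_ext => w; rewrite blin_addE blin_scaleE !gE ll.
have gM u : `|g u| <= M * `|u|.
  by apply: blin_normr_le => // v; rewrite gE.
exists (sval (blin_of_bounded lg M0 gM)) => u v.
by case: blin_of_bounded => /= T ->.
Qed.

Lemma blin_linear_left (E F G : normedModType K) (B : blin E (blin F G)) v :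
  linear (fun u => B u v).
Proof. by move=> a u w; rewrite linearP blin_addE blin_scaleE. Qed.

Lemma ler_bilinear (E F G : normedModType K) (B : blin E (blin F G)) u v :
  `|B u v| <= `|B| * `|u| * `|v|.
Proof.
apply: le_trans (ler_opnormr _ _) _.
by rewrite ler_wpM2r// ler_opnormr.
Qed.

Lemma blin_id (E : normedModType K) : {T : blin E E | forall x, T x = x}.
Proof.
apply: (@blin_of_bounded E E idfun 1) => // x.
by rewrite mul1r.
Qed.

(** Composition of operators is itself bounded bilinear.  Together with
[blin_flip] it generates every bilinear map needed for the Leibniz and chain
rules, without further norm estimates. *)
Lemma blin_comp (E F G : normedModType K) :
  {C : blin (blin F G) (blin (blin E F) (blin E G)) |
    forall S T x, C S T x = S (T x)}.
Proof.
have lc (S : blin F G) (T : blin E F) : linear (fun x => S (T x)).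
  by move=> a u v; rewrite !linearP.
have cM (S : blin F G) (T : blin E F) x : `|S (T x)| <= `|S| * `|T| * `|x|.
  apply: le_trans (ler_opnormr _ _) _.
  by rewrite -mulrA ler_wpM2l// ler_opnormr.
have c0 (S : blin F G) (T : blin E F) : 0 <= `|S| * `|T| by rewrite mulr_ge0.
pose c S T := sval (blin_of_bounded (lc S T) (c0 S T) (cM S T)).
have cE S T x : c S T x = S (T x) by rewrite /c; case: blin_of_bounded.
have [||||C CE] := @bilinear_of_bounded _ _ _ c 1.
- move=> S a T U; apply: blin_ext => x.
  by rewrite blin_addE blin_scaleE !cE blin_addE blin_scaleE linearP.
- move=> T a S U; apply: blin_ext => x.
  by rewrite blin_addE blin_scaleE !cE.
- exact: ler01.
- by move=> S T; rewrite mul1r; apply: blin_normr_le => // x; rewrite cE.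
by exists C => S T x; rewrite CE cE.
Qed.

Lemma blin_flip (E F G : normedModType K) (B : blin E (blin F G)) :
  {B' : blin F (blin E G) | forall v u, B' v u = B u v}.
Proof.
apply: (@bilinear_of_bounded _ _ _ (fun v u => B u v) `|B|) => //.
- by move=> v; exact: blin_linear_left.
- by move=> u; exact: linearP.
- by move=> v u; rewrite mulrAC ler_bilinear.
Qed.

Lemma bilinear_subl (E F G : normedModType K) (B : blin E (blin F G)) u w v :
  B (u - w) v = B u v - B w v.
Proof. by rewrite linearB. Qed.

Lemma bilinear_continuous (E F G : normedModType K) (B : blin E (blin F G)) :
  continuous (fun p : E * F => B p.1 p.2).
Proof.
move=> q; apply/cvgrPdist_le => e e0.
have e2 : 0 < e / 2 by rewrite divr_gt0.
pose M := `|B| * (`|q.2| + 1) + 1.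
have M0 : 0 < M by rewrite ltr_wpDl// mulr_ge0// addr_ge0.
pose N := `|B q.1| + 1.
have N0 : 0 < N by rewrite ltr_wpDl.
near=> p.
have -> : B q.1 q.2 - B p.1 p.2 = B (q.1 - p.1) p.2 + B q.1 (q.2 - p.2).
  by rewrite bilinear_subl linearB [RHS]addrC subrKA.
have h1 : `|q.1 - p.1| <= e / 2 / M.
  by near: p; apply: cvgr_dist_le; [exact: cvg_fst|rewrite divr_gt0].
have h2 : `|q.2 - p.2| <= e / 2 / N.
  by near: p; apply: cvgr_dist_le; [exact: cvg_snd|rewrite divr_gt0].
have h3 : `|p.2| <= `|q.2| + 1.
  near: p; apply: (cvgr_norm_le q.2); first exact: cvg_snd.
  by rewrite ltrDl.
rewrite (splitr e); apply: le_trans (ler_normD _ _) _; apply: lerD.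
  apply: le_trans (ler_bilinear _ _ _) _.
  rewrite mulrAC; apply: (@le_trans _ _ (M * (e / 2 / M))).
    apply: ler_pM => //.
    by rewrite (le_trans (ler_wpM2l _ h3))// lerDl.
  by rewrite mulrC divfK// gt_eqF.
apply: le_trans (ler_opnormr _ _) _.
apply: (@le_trans _ _ (N * (e / 2 / N))).
  by apply: ler_pM => //; rewrite lerDl.
by rewrite mulrC divfK// gt_eqF.
Unshelve. all: by end_near.
Qed.

Lemma is_diff_bilinear (X E F G : normedModType K) (B : blin E (blin F G))
    (u du : X -> E) (v dv : X -> F) x :
  is_diff x u du -> is_diff x v dv ->
  is_diff x (fun y => B (u y) (v y))
    (fun h => B (du h) (v x) + B (u x) (dv h)).
Proof.
move=> Du Dv.
have Bbil : bilinear_for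
    (GRing.Scale.Law.clone _ _ *:%R _) (GRing.Scale.Law.clone _ _ *:%R _)
    (fun u v => B u v : G).
  by split=> [v'|u'] a y z /=; [exact: blin_linear_left|exact: linearP].
pose b : {bilinear E -> F -> G} := HB.pack (fun u v => B u v : G)
  (bilinear_isBilinear.Build _ _ _ _ _ _ (fun u v => B u v : G) Bbil).
have bc : continuous (fun p => b p.1 p.2) by exact: bilinear_continuous.
have Db : is_diff (u x, v x) (fun p => b p.1 p.2)
    (fun q => b (u x) q.2 + b q.1 (v x)).
  by apply: DiffDef; [exact: differentiable_bilin|exact: diff_bilin].
have := is_diff_comp (is_diff_pair Du Dv) Db.
by move=> /is_diff_eq; apply; apply/funext => h /=; rewrite addrC.
Qed.

Lemma is_diff_blin (E F : normedModType K) (T : blin E F) x : is_diff x T T.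
Proof.
by apply: DiffDef;
  [apply: linear_differentiable|apply: diff_lin]; exact: blin_continuous.
Qed.

Lemma is_diff_deriv_blin (E F : normedModType K) (g : E -> F) x :
  differentiable g x -> is_diff x g (deriv_blin g x).
Proof. by move=> dg; apply: DiffDef => //; rewrite deriv_blinE. Qed.

Lemma deriv_blin_val (E F : normedModType K) (g dg : E -> F) x :
  is_diff x g dg -> deriv_blin g x = dg :> (E -> F).
Proof. by move=> Dg; rewrite deriv_blinE// diff_val. Qed.

(** The differential is characterised by an estimate in which no choice of a
linear map is hidden; both the mean value inequality and the locality of the
derivative rest on it. *)
Lemma is_diffP (E F : normedModType K) (g : E -> F) x (T : blin E F) :
  is_diff x g T <->
  forall e : K, 0 < e ->
    \forall y \near x, `|g y - g x - T (y - x)| <= e * `|y - x|.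
Proof.
have oP : (g \o shift x = cst (g x) + T +o_ 0 id) <->
    forall e : K, 0 < e ->
    \forall y \near x, `|g y - g x - T (y - x)| <= e * `|y - x|.
  rewrite eqaddoP; split=> H e e0; have := H e e0; last first.
    move=> /nbhs0P; apply: filterS => y /=.
    by rewrite [x + y]addrC addrK !fctE opprD addrA.
  move=> near0; apply/nbhs0P; apply: filterS near0 => y /=.
  by rewrite [x + y]addrC addrK !fctE opprD addrA.
split=> [Dg|/oP Tg].
  by apply/oP; rewrite -(diff_val (is_diff_def := Dg)); exact: diff_locally.
have Tc : continuous T by exact: blin_continuous.
have dgT : 'd g x = T :> (E -> F) by exact: diff_unique.
by apply: DiffDef => //; apply/diff_locallyP; rewrite dgT.
Qed.

Lemma deriv_blin_unique (E F : normedModType K) (g : E -> F) x (T : blin E F) :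
  is_diff x g T -> deriv_blin g x = T.
Proof.
by move=> Dg; apply: blin_ext => h; exact: (congr1 (@^~ h) (deriv_blin_val Dg)).
Qed.

Lemma near_eq_is_diff (E F : normedModType K) (g h dg : E -> F) x :
  (\forall y \near x, g y = h y) -> is_diff x g dg -> is_diff x h dg.
Proof.
move=> gh Dg; rewrite -(deriv_blin_val Dg); apply/is_diffP => e e0.
have ghx : g x = h x := nbhs_singleton gh.
have /is_diffP/(_ e e0) : is_diff x g (deriv_blin g x).
  exact: is_diff_deriv_blin.
by apply: filterS2 gh => y <-; rewrite ghx.
Qed.

End BoundedOperators.

(** * Iterated differentiability *)

Section IteratedDifferentiability.
Variables (R : realType) (k : scalar_kind).
Local Notation K := (scalars R k).
Variable X : normedModType K.

Lemma ndifferentiable_le (W : normedModType K) (m n : nat) (g : X -> W) x :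
  (m <= n)%N -> ndifferentiable n g x -> ndifferentiable m g x.
Proof.
move=> /subnK <-; elim: (n - m)%N => // p IH.
by rewrite addSn => -[/nbhs_singleton/IH].
Qed.

Lemma differentiable_nderiv (W : normedModType K) (m n : nat) (g : X -> W) x :
  (m < n)%N -> ndifferentiable n g x -> differentiable (nderiv m g) x.
Proof. by move=> mn /(ndifferentiable_le mn)[]. Qed.

Lemma ndifferentiable_differentiable (W : normedModType K) n (g : X -> W) x :
  ndifferentiable n.+1 g x -> differentiable g x.
Proof. exact: (@differentiable_nderiv W 0). Qed.

Lemma near_eq_nderiv (W : normedModType K) n (g h : X -> W) x :
  (\forall y \near x, g y = h y) -> ndifferentiable n g x ->
  ndifferentiable n h x /\ nderiv n g x = nderiv n h x.
Proof.
elim: n x => [|n IH] x gh; first by move=> _; split=> //; exact: (nbhs_singleton gh).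
move=> [ng dg].
have {}IH : \forall y \near x,
    ndifferentiable n h y /\ nderiv n g y = nderiv n h y.
  by apply: filterS2 ng (near_join gh) => y ngy ghy; exact: IH.
have Dh : is_diff x (nderiv n h) (deriv_blin (nderiv n g) x).
  apply: near_eq_is_diff (is_diff_deriv_blin dg).
  by apply: filterS IH => y [].
split; first by split; [apply: filterS IH => y []|exact: ex_diff].
apply/esym/blin_ext => v; exact: (congr1 (@^~ v) (deriv_blin_val Dh)).
Qed.

(** The isomorphism between n-linear maps with values in L(X, W) and
(n+1)-linear maps with values in W; here the variable of the inner L(X, W) is
the last one. *)
Fixpoint uncurry (W : normedModType K) n :
    blin (multilin X (blin X W) n) (multilin X W n.+1) :=
  match n with
  | 0 => sval (blin_id (blin X W))
  | n'.+1 => sval (blin_comp X _ _) (uncurry W n')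
  end.

Fixpoint curry (W : normedModType K) n :
    blin (multilin X W n.+1) (multilin X (blin X W) n) :=
  match n with
  | 0 => sval (blin_id (blin X W))
  | n'.+1 => sval (blin_comp X _ _) (curry W n')
  end.

Lemma uncurryK (W : normedModType K) n : cancel (uncurry W n) (curry W n).
Proof.
elim: n => [|n IH] A /=; first by case: blin_id => T TE /=; rewrite !TE.
apply: blin_ext => v; case: blin_comp => C CE; case: blin_comp => D DE /=.
by rewrite CE DE IH.
Qed.

(** An (n+1)-fold derivative is the n-fold derivative of the first derivative,
up to the isomorphism [uncurry].  Differentiability of the two sides is the
same because [uncurry] and [curry] are bounded linear. *)
Lemma nderivSr (W : normedModType K) n (g : X -> W) x :
  ndifferentiable n.+1 g x ->
  ndifferentiable n (deriv_blin g) x /\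
  nderiv n.+1 g x = uncurry W n (nderiv n (deriv_blin g) x).
Proof.
elim: n x => [|n IH] x; first by split=> //=; case: blin_id => T ->.
move=> [ng dg].
have {}IH : \forall y \near x, ndifferentiable n (deriv_blin g) y /\
    nderiv n.+1 g y = uncurry W n (nderiv n (deriv_blin g) y).
  by apply: filterS ng => y; exact: IH.
have nE : \forall y \near x,
    curry W n (nderiv n.+1 g y) = nderiv n (deriv_blin g) y.
  by apply: filterS IH => y [_ ->]; rewrite uncurryK.
have Dn := near_eq_is_diff nE
  (is_diff_comp (is_diff_deriv_blin dg) (is_diff_blin (curry W n) _)).
have dn : differentiable (nderiv n (deriv_blin g)) x by exact: ex_diff.
split; first by split; [apply: filterS IH => y []|].
have En : \forall y \near x,
    uncurry W n (nderiv n (deriv_blin g) y) = nderiv n.+1 g y.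
  by apply: filterS IH => y [].
have En' := near_eq_is_diff En
  (is_diff_comp (is_diff_deriv_blin dn) (is_diff_blin (uncurry W n) _)).
apply: blin_ext => v; rewrite [LHS](congr1 (@^~ v) (deriv_blin_val En')).
by rewrite /=; case: (blin_comp X) => C CE /=; rewrite CE.
Qed.

(** A converse of [nderivSr], by which n-fold differentiability of an explicitly
computed first derivative is turned into (n+1)-fold differentiability. *)
Lemma ndifferentiableSr (W : normedModType K) n (g : X -> W) x :
  (\forall y \near x, differentiable g y) ->
  ndifferentiable n (deriv_blin g) x -> ndifferentiable n.+1 g x.
Proof.
elim: n x => [|n IH] x dg; first by split; [exact: filterE|exact: (nbhs_singleton dg)].
move=> [nDg dDg].
have ng : \forall y \near x, ndifferentiable n.+1 g y.
  by apply: filterS2 nDg (near_join dg) => y nDgy dgy; exact: IH.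
split=> //.
have nE : \forall y \near x,
    uncurry W n (nderiv n (deriv_blin g) y) = nderiv n.+1 g y.
  by apply: filterS ng => y /nderivSr[].
have := near_eq_is_diff nE
  (is_diff_comp (is_diff_deriv_blin dDg) (is_diff_blin (uncurry W n) _)).
by move=> ?; exact: ex_diff.
Qed.

Lemma ndifferentiable_near (W : normedModType K) n (g : X -> W) x :
  ndifferentiable n.+2 g x -> \forall y \near x, differentiable g y.
Proof. by case=> ng _; apply: filterS ng => y; exact: ndifferentiable_differentiable. Qed.

Lemma ndifferentiableD (W : normedModType K) n (g h : X -> W) x :
  ndifferentiable n g x -> ndifferentiable n h x ->
  ndifferentiable n (fun y => g y + h y) x.
Proof.
suff H : ndifferentiable n g x -> ndifferentiable n h x ->
  ndifferentiable n (fun y => g y + h y) x /\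
  nderiv n (fun y => g y + h y) x = nderiv n g x + nderiv n h x.
  by move=> ng nh; case: H.
elim: n x => [|n IH] x //= [ng dg] [nh dh].
have {}IH : \forall y \near x, ndifferentiable n (fun y => g y + h y) y /\
    nderiv n g y + nderiv n h y = nderiv n (fun y => g y + h y) y.
  by apply: filterS2 ng nh => y ngy nhy; case: (IH y).
have nE : \forall y \near x,
    (nderiv n g + nderiv n h) y = nderiv n (fun y => g y + h y) y.
  by apply: filterS IH => y [].
have DE := near_eq_is_diff nE
  (is_diffD (is_diff_deriv_blin dg) (is_diff_deriv_blin dh)).
split; first by split; [apply: filterS IH => y []|exact: ex_diff].
by apply: blin_ext => v; rewrite (deriv_blin_val DE).
Qed.

(** The derivative B(Du, v) + B(u, Dv) of B(u, v) is a sum of bounded bilinear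
maps applied to functions that are one time less differentiable, so the
induction is over all target spaces at once. *)
Lemma ndifferentiable_bilinear n (E F G : normedModType K)
    (B : blin E (blin F G)) (u : X -> E) (v : X -> F) x :
  ndifferentiable n u x -> ndifferentiable n v x ->
  ndifferentiable n (fun y => B (u y) (v y)) x.
Proof.
elim: n E F G B u v x => [|[|n] IH] E F G B u v x //.
  move=> [_ du] [_ dv]; split; first exact: filterE.
  have D := is_diff_bilinear B (is_diff_deriv_blin du) (is_diff_deriv_blin dv).
  exact: ex_diff.
move=> nu nv.
have du := ndifferentiable_near nu; have dv := ndifferentiable_near nv.
have [B1 B1E] : exists B1 : blin (blin X E) (blin F (blin X G)),
    forall T w h, B1 T w h = B (T h) w.
  have [B' B'E] := blin_flip B; have [C CE] := blin_comp X E G.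
  have [C' C'E] := blin_comp F (blin E G) (blin (blin X E) (blin X G)).
  have [B1 B1E] := blin_flip (C' C B').
  by exists B1 => T w h; rewrite B1E C'E CE B'E.
have [B2 B2E] : exists B2 : blin E (blin (blin X F) (blin X G)),
    forall w T h, B2 w T h = B w (T h).
  have [C CE] := blin_comp X F G.
  have [C' C'E] := blin_comp E (blin F G) (blin (blin X F) (blin X G)).
  by exists (C' C B) => w T h; rewrite C'E CE.
have DE : \forall y \near x,
    B1 (deriv_blin u y) (v y) + B2 (u y) (deriv_blin v y) =
    deriv_blin (fun y => B (u y) (v y)) y.
  apply: filterS2 du dv => y /is_diff_deriv_blin du /is_diff_deriv_blin dv.
  apply: blin_ext => h; rewrite blin_addE B1E B2E.
  by rewrite (deriv_blin_val (is_diff_bilinear B du dv)).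
apply: ndifferentiableSr.
  apply: filterS2 du dv => y /is_diff_deriv_blin du /is_diff_deriv_blin dv.
  by have D := is_diff_bilinear B du dv; exact: ex_diff.
apply: (near_eq_nderiv DE _).1; apply: ndifferentiableD; apply: IH.
- exact: (nderivSr nu).1.
- by apply: ndifferentiable_le nv.
- by apply: ndifferentiable_le nu.
- exact: (nderivSr nv).1.
Qed.

End IteratedDifferentiability.

Lemma ndifferentiable_comp (R : realType) (k : scalar_kind)
    (X Y V : normedModType (scalars R k)) n (phi : X -> Y) (f : Y -> V) x :
  ndifferentiable n phi x -> ndifferentiable n f (phi x) ->
  ndifferentiable n (f \o phi) x.
Proof.
elim: n V f x => [|[|n] IH] V f x //.
  move=> [_ dphi] [_ df]; split; first exact: filterE.
  exact: differentiable_comp.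
move=> nphi nf.
have dphi := ndifferentiable_near nphi.
have df : \forall y \near x, differentiable f (phi y).
  have cphi : {for x, continuous phi}.
    by apply: differentiable_continuous; exact: ndifferentiable_differentiable nphi.
  exact: (cphi _ (ndifferentiable_near nf)).
have [C CE] := blin_comp X Y V.
have DE : \forall y \near x,
    C (deriv_blin f (phi y)) (deriv_blin phi y) = deriv_blin (f \o phi) y.
  apply: filterS2 dphi df => y /is_diff_deriv_blin dp /is_diff_deriv_blin dfy.
  by apply: blin_ext => h; rewrite CE (deriv_blin_val (is_diff_comp dp dfy)).
apply: ndifferentiableSr.
  by apply: filterS2 dphi df => y; exact: differentiable_comp.
apply: (near_eq_nderiv DE _).1.
apply: (@ndifferentiable_bilinear _ _ _ _ _ _ _ C
  (deriv_blin f \o phi) (deriv_blin phi)); last exact: (nderivSr nphi).1.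
apply: IH; last exact: (nderivSr nf).1.
by apply: ndifferentiable_le nphi.
Qed.

(** * The mean value inequality and the symmetry of derivatives *)

(** The mean value inequality reduced to its order-theoretic core: [D s t] is to
be read as the distance between the values at times [s] and [t] of a curve.
The supremum [c] of the times [t] with [D 0 t <= C * t] is attained, and it
equals 1 since the local bound at [c] would otherwise carry the inequality
beyond [c]. *)
Lemma straddle_le (R : realType) (D : R -> R -> R) (C : R) :
  (forall s t u, D s u <= D s t + D t u) ->
  (forall t, 0 <= t <= 1 -> exists2 d, 0 < d &
    forall s, 0 <= s <= 1 -> `|s - t| < d ->
      D s t <= C * `|s - t| /\ D t s <= C * `|s - t|) ->
  D 0 1 <= C.
Proof.
move=> tri loc.
pose S : set R := [set t | 0 <= t <= 1 /\ D 0 t <= C * t].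
have S0 : S 0.
  split; first by rewrite lexx ler01.
  have [d d0 /(_ 0)] := loc 0 ltac:(by rewrite lexx ler01).
  by rewrite subr0 normr0 lexx ler01 => /(_ isT d0)[].
have S1 : ubound S 1 by move=> t [/andP[]].
have supS : has_sup S by split; [exists 0|exists 1].
pose c := sup S.
have c01 : 0 <= c <= 1.
  by rewrite (sup_upper_bound supS)//= ge_sup//; exists 0.
have [d d0 dP] := loc c c01.
have Sc : D 0 c <= C * c.
  have [t [t01 tC] ct] := sup_adherent d0 supS.
  have tc : t <= c by exact: (sup_upper_bound supS).
  have [] := dP t t01; first by rewrite ler0_norm ?subr_le0// opprB ltrBlDr -ltrBlDl.
  rewrite ler0_norm ?subr_le0// opprB => Dtc _.
  apply: le_trans (tri 0 t c) _; apply: le_trans (lerD tC Dtc) _.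
  by rewrite -mulrDr addrC subrK.
have [c1|] := ltP c 1; last first.
  move=> c1; suff c1' : c = 1 by move: Sc; rewrite c1' mulr1.
  by apply/le_anti; rewrite c1; case/andP: c01 => _ ->.
pose s := Num.min 1 (c + d / 2).
have cs : c < s by rewrite lt_min c1 ltrDl divr_gt0.
have s01 : 0 <= s <= 1.
  by rewrite ge_min lexx (le_trans _ (ltW cs))//; case/andP: c01.
have sd : s < c + d.
  by rewrite gt_min ltrD2l gtr_pMr// invf_lt1// ltr1n orbT.
suff /(sup_upper_bound supS) : S s by rewrite leNgt cs.
split=> //.
have [] := dP s s01; first by rewrite gtr0_norm ?subr_gt0// ltrBlDl.
rewrite gtr0_norm ?subr_gt0// => _ Dcs.
apply: le_trans (tri 0 c s) _; apply: le_trans (lerD Sc Dcs) _.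
by rewrite -mulrDr addrC subrK.
Qed.

(** The regrouping that absorbs a linear perturbation [r] of the increments. *)
Lemma subr_shear (U : zmodType) (p q r s : U) :
  p - q - s = p - (r + s) - (q - r).
Proof. by rewrite opprB addrA opprD addrA [p - r - s + r]addrAC subrK addrAC. Qed.

Section MeanValue.
Variables (R : realType) (k : scalar_kind).
Local Notation K := (scalars R k).
Local Notation of_real := (of_real (R := R) k).
Local Notation re_part := (re_part (R := R) (k := k)).

Lemma of_realB r s : of_real (r - s) = of_real r - of_real s.
Proof. by apply/eqP; rewrite eq_sym subr_eq -of_realD subrK. Qed.

Lemma ltr_of_real r s : (of_real r < of_real s) = (r < s).
Proof. by rewrite !lt_neqAle ler_of_real (can_eq (@of_realK R k)). Qed.

Lemma of_real1 : of_real 1 = 1.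
Proof. by rewrite /Defs.of_real; case: k. Qed.

Lemma normr_of_real r : `|of_real r| = of_real `|r|.
Proof.
have [r0|r0] := ler0P r.
  rewrite ler0_norm; last by rewrite -(of_real0 R k) ler_of_real.
  by rewrite -[- r]sub0r of_realB of_real0 sub0r.
by rewrite ger0_norm// -(of_real0 R k) ler_of_real ltW.
Qed.

Lemma re_part_gt0 (z : K) : 0 < z -> 0 < re_part z.
Proof.
move=> z0; rewrite lt_neqAle re_part_ge0 ?ltW// andbT eq_sym.
apply: contraTneq z0 => z0; rewrite lt_neqAle; apply/negP => /andP[+ z0'].
by rewrite -(re_partK z0') z0 of_real0 eqxx.
Qed.

(** The scalars may be complex, so the segment from [a] to [a + u] is
parametrised by real numbers embedded in the scalars. *)
Lemma mean_value_le (E F : normedModType K) (g : E -> F) (a u : E) (C : K) :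
  0 <= C ->
  (forall t, 0 <= t <= 1 -> differentiable g (a + of_real t *: u) /\
    `|deriv_blin g (a + of_real t *: u) u| <= C) ->
  `|g (a + u) - g a| <= C.
Proof.
move=> C0 dg.
rewrite -ler_re_part//; apply/ler_addgt0Pr => e e0.
pose p t := a + of_real t *: u.
pose D s t := re_part `|g (p t) - g (p s)|.
suff : D 0 1 <= re_part C + e.
  by rewrite /D /p of_real0 of_real1 scale0r addr0 scale1r.
apply: straddle_le => [s t w|t t01].
  rewrite -(ler_of_real k) of_realD !re_partK//.
  by rewrite [leRHS]addrC -[X in `|X| <= _](subrKA (g (p t))) ler_normD.
have [dgt Cu] := dg t t01; set L := deriv_blin g _ in Cu.
have u1 : 0 < `|u| + 1 by rewrite ltr_wpDl.
have e'0 : 0 < of_real e by rewrite -(of_real0 R k) ltr_of_real.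
have /is_diffP/(_ (of_real e / (`|u| + 1))) := is_diff_deriv_blin dgt.
rewrite divr_gt0// => /(_ isT)/nbhs_ballP[d /= d0 dP].
exists (re_part (d / (`|u| + 1))); first by rewrite re_part_gt0// divr_gt0.
move=> s s01 std.
have pE : p s - p t = of_real (s - t) *: u.
  by rewrite /p opprD addrACA subrr add0r -scalerBl of_realB.
have bs : ball (p t) d (p s).
  rewrite -ball_normE /ball_ /= distrC pE normrZ normr_of_real.
  move: std; rewrite -ltr_of_real re_partK ?divr_ge0 ?ltW//.
  rewrite ltr_pdivlMr//; apply: le_lt_trans.
  by rewrite ler_wpM2l ?lerDl// -normr_of_real.
suff H : re_part `|g (p s) - g (p t)| <= (re_part C + e) * `|s - t|.
  by split=> //; rewrite /D distrC.
rewrite -(ler_of_real k) of_realM of_realD !re_partK// -normr_of_real.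
have := dP _ bs; rewrite -/(p t) -/L pE => dPs.
rewrite -[X in `|X|](subrK (L (of_real (s - t) *: u))).
apply: le_trans (ler_normD _ _) _.
rewrite addrC mulrDl; apply: lerD.
  by rewrite linearZ normrZ mulrC ler_wpM2r.
apply: le_trans dPs _; rewrite normrZ.
rewrite mulrCA mulrC ler_wpM2r// -mulrA ler_piMr ?(ltW e'0)//.
by rewrite mulrC ler_pdivrMr// mul1r lerDl.
Qed.

(** The second difference is the increment over [u] of z |-> g(z + v) - g(z).
After subtraction of the linear map [A v], the derivative of this function is
of size [e * (|u| + |v|)] near [x], and the mean value inequality applies. *)
Lemma second_difference_le (E F : normedModType K) (g : E -> F) x
    (A : blin E (blin E F)) (e d : K) (u v : E) : 0 < e ->
  (forall y, ball x d y -> differentiable g y /\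
    `|deriv_blin g y - deriv_blin g x - A (y - x)| <= e * `|y - x|) ->
  `|u| + `|v| < d ->
  `|(g (x + u + v) - g (x + u)) - (g (x + v) - g x) - A v u|
    <= 2 * e * (`|u| + `|v|) ^+ 2.
Proof.
move=> e0 dP uvd; set N := `|u| + `|v|.
have N0 : 0 <= N by rewrite addr_ge0.
(* Subtracting A v z makes the derivative of G small near x. *)
pose G z := g (z + v) - g z - A v z.
have -> : g (x + u + v) - g (x + u) - (g (x + v) - g x) - A v u =
    G (x + u) - G x.
  by rewrite /G [A v (x + u)]linearD; exact: subr_shear.
apply: mean_value_le; first by rewrite !mulr_ge0 ?exprn_ge0// ltW.
move=> t t01; set z := x + _.
have tu : `|of_real t *: u| <= `|u|.
  rewrite normrZ normr_of_real ler_piMl// -of_real1 ler_of_real.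
  by case/andP: t01 => t0 t1; rewrite ger0_norm.
have tuN : `|of_real t *: u| <= N by rewrite (le_trans tu)// lerDl.
have tuvN : `|of_real t *: u + v| <= N.
  by rewrite (le_trans (ler_normD _ _))// lerD2r.
have zx : z - x = of_real t *: u by rewrite /z [x + _]addrC addrK.
have zvx : z + v - x = of_real t *: u + v by rewrite addrAC zx.
have bz : ball x d z.
  rewrite -ball_normE /ball_ /= distrC zx.
  exact: le_lt_trans tuN uvd.
have bzv : ball x d (z + v).
  rewrite -ball_normE /ball_ /= distrC zvx.
  exact: le_lt_trans tuvN uvd.
have [dgz hz] := dP _ bz; have [dgzv hzv] := dP _ bzv.
have DG : is_diff z G (deriv_blin g (z + v) - deriv_blin g z - A v).
  have Dv : is_diff z (fun z => g (z + v)) (deriv_blin g (z + v)).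
    have Ds : is_diff z (fun z => z + v) id.
      have := is_diffD (is_diff_id z) (is_diff_cst v z).
      by move/is_diff_eq; apply; apply/funext => h /=; rewrite !fctE addr0.
    exact: (is_diff_comp Ds (is_diff_deriv_blin dgzv)).
  have := is_diffB (is_diffB Dv (is_diff_deriv_blin dgz)) (is_diff_blin (A v) z).
  by [].
split; first exact: ex_diff.
have -> : deriv_blin G z = deriv_blin g (z + v) - deriv_blin g z - A v.
  exact: deriv_blin_unique.
have -> : deriv_blin g (z + v) - deriv_blin g z - A v =
   (deriv_blin g (z + v) - deriv_blin g x - A (z + v - x)) -
   (deriv_blin g z - deriv_blin g x - A (z - x)).
  have -> : z + v - x = z - x + v by rewrite addrAC.
  rewrite [A (_ + v)]linearD -subr_shear.
  by congr (_ - _); rewrite opprB addrA subrK.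
apply: le_trans (ler_opnormr _ _) _.
apply: (@le_trans _ _ ((2 * e * N) * N)); last by rewrite expr2 mulrA.
apply: ler_pM => //; last by rewrite lerDl.
apply: le_trans (ler_normB _ _) _.
rewrite -mulrA mulr_natl mulr2n; apply: lerD.
  by apply: le_trans hzv _; rewrite ler_pM2l// zvx.
by apply: le_trans hz _; rewrite ler_pM2l// zx.
Qed.

(** The second difference is symmetric in [u] and [v], hence
|A u v - A v u| <= 4 e (|u| + |v|)^2 for small [u] and [v]; both sides are
homogeneous of degree 2, so the bound holds everywhere, for every [e > 0]. *)
Lemma second_derivative_sym (E F : normedModType K) (g : E -> F) x :
  (\forall y \near x, differentiable g y) ->
  differentiable (deriv_blin g) x ->
  forall u v, deriv_blin (deriv_blin g) x u v = deriv_blin (deriv_blin g) x v u.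
Proof.
move=> dg ddg; set A := deriv_blin (deriv_blin g) x.
have small (e : K) : 0 < e -> exists2 d, 0 < d & forall u v,
    `|u| + `|v| < d -> `|A u v - A v u| <= 4 * e * (`|u| + `|v|) ^+ 2.
  move=> e0.
  have /is_diffP/(_ e e0) eA := is_diff_deriv_blin ddg.
  have [d /= d0 dP] := (nbhs_ballP _ _).1 (filterI dg eA).
  exists d => // u v uvd.
  have h1 := second_difference_le e0 dP uvd.
  have vud : `|v| + `|u| < d by rewrite addrC.
  have h2 := second_difference_le e0 dP vud.
  have -> : 4 * e * (`|u| + `|v|) ^+ 2 =
    2 * e * (`|u| + `|v|) ^+ 2 + 2 * e * (`|v| + `|u|) ^+ 2.
    by rewrite [`|v| + _]addrC -!mulrDl -natrD.
  apply: le_trans (lerD h1 h2); apply: le_trans (ler_normB _ _).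
  rewrite -/A [x + v + u]addrAC.
  have -> : g (x + u + v) - g (x + v) - (g (x + u) - g x) =
      g (x + u + v) - g (x + u) - (g (x + v) - g x).
    rewrite !opprB -!addrA; congr (_ + _); rewrite addrCA [RHS]addrCA.
    by congr (_ + _); exact: addrC.
  by rewrite [- (_ - A u v)]opprB [X in _ <= `|X|]addrC subrKA.
move=> u v; apply/eqP; rewrite -subr_eq0 -normr_le0.
set N := `|u| + `|v|.
have N0 : 0 <= N by rewrite addr_ge0.
have N1 : 0 < N + 1 by rewrite ltr_wpDl.
have N2 : 0 < 4 * (N ^+ 2 + 1) by rewrite mulr_gt0// ltr_wpDl// exprn_ge0.
apply/ler_addgt0Pl => e e0; rewrite addr0.
have [d d0 dP] := small _ (divr_gt0 e0 N2).
(* Shrink u and v by a factor t to enter the ball where the bound holds. *)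
have [t t0 tNd] : exists2 t : K, 0 < t & t * N < d.
  exists (d / (N + 1)); first by rewrite divr_gt0.
  by rewrite mulrAC ltr_pdivrMr// ltr_pM2l// ltrDl.
have tuv : `|t *: u| + `|t *: v| = t * N.
  by rewrite !normrZ (gtr0_norm t0) -mulrDr.
have tN : `|t *: u| + `|t *: v| < d by rewrite tuv.
have tA w z : A (t *: w) (t *: z) = t *: (t *: A w z).
  by rewrite [LHS]linearZ; congr (_ *: _); rewrite [A _]linearZ.
have := dP _ _ tN; rewrite tuv !tA -!scalerBr.
rewrite !normrZ (gtr0_norm t0) exprMn.
rewrite mulrA -expr2 mulrCA ler_pM2l ?exprn_gt0// => /le_trans; apply.
rewrite mulrAC mulrCA ler_piMr ?(ltW e0)// ler_pdivrMr// mul1r.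
by rewrite ler_pM2l// lerDl.
Qed.

End MeanValue.

Section IteratedSymmetry.
Variables (R : realType) (k : scalar_kind).
Local Notation K := (scalars R k).

(** The order of the derivative is read off the list of directions, so that lists
of provably but not syntactically equal sizes can be exchanged freely. *)
Definition mderiv (E F : normedModType K) (g : E -> F) (x : E) (s : seq E) : F :=
  meval (nderiv (size s) g x) s.

Lemma mderivE (E F : normedModType K) (g : E -> F) x s n :
  size s = n -> mderiv g x s = meval (nderiv n g x) s.
Proof. by move=> <-. Qed.

Lemma is_diff_unique (E F : normedModType K) (g dg dg' : E -> F) x :
  is_diff x g dg -> is_diff x g dg' -> dg = dg'.
Proof.
move=> Dg Dg'; rewrite -(diff_val (is_diff_def := Dg)).
exact: (diff_val (is_diff_def := Dg')).
Qed.

Lemma is_diff_eval (X E F : normedModType K) (A dA : X -> blin E F)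
    (w dw : X -> E) x :
  is_diff x A dA -> is_diff x w dw ->
  is_diff x (fun y => A y (w y)) (fun h => dA h (w x) + A x (dw h)).
Proof.
move=> DA Dw; have [I IE] := blin_id (blin E F).
have := is_diff_bilinear I DA Dw.
have -> : (fun y => I (A y) (w y)) = (fun y => A y (w y)).
  by apply/funext => y; rewrite IE.
by move/is_diff_eq; apply; apply/funext => h; rewrite !IE.
Qed.

Lemma is_diff_meval_cst (X E F : normedModType K) n
    (A dA : X -> multilin E F n) (s : seq E) x :
  is_diff x A dA ->
  is_diff x (fun y => meval (A y) s) (fun h => meval (dA h) s).
Proof.
elim: n A dA s => [|n IH] A dA s DA //=.
apply: (IH (fun y => A y (head 0 s)) (fun h => dA h (head 0 s))).
have := is_diff_eval DA (is_diff_cst (head 0 s) x).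
by move/is_diff_eq; apply; apply/funext => h /=; rewrite [A x _]linear0 addr0.
Qed.

Lemma is_diff_mderiv_cst (E F : normedModType K) (g : E -> F) (s : seq E) x :
  ndifferentiable (size s).+1 g x ->
  is_diff x (fun y => mderiv g y s) (fun h => mderiv g x (h :: s)).
Proof.
move=> ng; apply: (is_diff_meval_cst (A := nderiv (size s) g)
  (dA := fun h => deriv_blin (nderiv (size s) g) x h)).
exact/is_diff_deriv_blin/(differentiable_nderiv _ ng).
Qed.

Lemma mderiv_swap (E F : normedModType K) (g : E -> F) a b (s : seq E) x :
  ndifferentiable (size s).+2 g x ->
  mderiv g x [:: a, b & s] = mderiv g x [:: b, a & s].
Proof.
move=> [ng dg]; congr (meval _ s) => /=.
apply: (second_derivative_sym _ dg).
by apply: filterS ng => y [].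
Qed.

(** A permutation that keeps the first direction is handled by differentiating
the symmetry of the lower derivative, which holds in a neighbourhood.  If the
first directions [a] and [b] differ, both lists are first rearranged to start
with [a] and [b], and the two are swapped. *)
Lemma mderiv_perm (E F : normedModType K) (g : E -> F) (s t : seq E) x :
  perm_eq s t -> ndifferentiable (size s) g x -> mderiv g x s = mderiv g x t.
Proof.
move: {2}(size s) (erefl (size s)) => n.
elim: n s t x => [|n IH] s t x.
  move=> /size0nil -> /perm_size/esym/size0nil -> //.
have cons a s' t' : size s' = n -> perm_eq s' t' ->
    ndifferentiable n.+1 g x -> mderiv g x (a :: s') = mderiv g x (a :: t').
  move=> sn st ng.
  have tn : size t' = n by rewrite -(perm_size st).
  have e : \forall y \near x, mderiv g y s' = mderiv g y t'.
    by case: ng => ng _; apply: filterS ng => y ngy; apply: IH; rewrite ?sn.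
  have Ds : is_diff x (fun y => mderiv g y s') (fun h => mderiv g x (h :: s')).
    by apply: is_diff_mderiv_cst; rewrite sn.
  have Dt : is_diff x (fun y => mderiv g y t') (fun h => mderiv g x (h :: t')).
    by apply: is_diff_mderiv_cst; rewrite tn.
  exact: (congr1 (@^~ a) (is_diff_unique (near_eq_is_diff e Ds) Dt)).
case: s => // a s [sn]; case: t => [|b t]; first by move/perm_size.
rewrite [size (a :: s)]/= sn => st ng.
have tn : size t = n by have := perm_size st; rewrite /= sn => -[].
have [ab|ab] := eqVneq a b.
  by rewrite -ab; apply: cons => //; move: st; rewrite ab perm_cons.
have bs : b \in s.
  by have := perm_mem st b; rewrite !inE eqxx eq_sym (negbTE ab).
have sb := perm_to_rem bs; set r := rem b s in sb.
have ta : perm_eq t (a :: r).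
  rewrite -(perm_cons b) perm_sym; apply: perm_trans st.
  rewrite (perm_catCA [:: b] [:: a] r) /= perm_cons perm_sym.
  exact: sb.
rewrite (cons a _ _ sn sb ng) (cons b _ _ tn ta ng).
have rn : (size r).+1 = n by rewrite -sn (perm_size sb).
by apply: mderiv_swap; rewrite rn.
Qed.

Lemma mevalD (E F : normedModType K) n (A B : multilin E F n) s :
  meval (A + B) s = meval A s + meval B s.
Proof.
elim: n A B s => // n IH A B s.
exact: (IH (A (head 0 s)) (B (head 0 s))).
Qed.

(** The derivative of A(y)(w_1(y), ..., w_n(y)).  The factors are indexed by a
duplicate-free list, so that replacing a factor by its derivative can be
written as a conditional on the index. *)
Lemma is_diff_meval (T : eqType) (X E F : normedModType K) (l : seq T)
    (A dA : X -> multilin E F (size l)) (w dw : T -> X -> E) x :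
  uniq l -> is_diff x A dA -> (forall i, i \in l -> is_diff x (w i) (dw i)) ->
  is_diff x (fun y => meval (A y) [seq w i y | i <- l])
    (fun h => meval (dA h) [seq w i x | i <- l] +
      \sum_(i <- l) meval (A x) [seq if j == i then dw j h else w j x | j <- l]).
Proof.
elim: l A dA => [|i l IH] /= A dA.
  move=> _ DA _; apply: is_diff_eq DA _.
  by apply/funext => h; rewrite big_nil addr0.
move=> /andP[il ul] DA Dw.
have Di : is_diff x (w i) (dw i) by apply: Dw; rewrite mem_head.
have Dl j : j \in l -> is_diff x (w j) (dw j).
  by move=> jl; apply: Dw; rewrite inE jl orbT.
have := IH _ _ ul (is_diff_eval DA Di) Dl.
move/is_diff_eq; apply; apply/funext => h.
rewrite big_cons eqxx addrA; congr (_ + _).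
  rewrite mevalD; congr (_ + meval _ _).
  by apply/eq_in_map => j jl; case: eqP il => // <-; rewrite jl.
rewrite !big_seq; apply: eq_bigr => j jl.
have ij : i != j by apply: contraNneq il => ->.
by rewrite (negbTE ij).
Qed.

End IteratedSymmetry.

(** * Partitions of a set with one more element *)

Section Partitions.
Import mathcomp.boot.fintype mathcomp.boot.finset.
Local Open Scope set_scope.
Variable T : finType.
Implicit Types (A P : {set T}) (Q : {set {set T}}).

Lemma setD1_id (S : finType) (x : S) (A : {set S}) : x \notin A -> A :\ x = A.
Proof.
move=> xA; apply/setP => y; rewrite !inE.
by case: eqP => // ->; rewrite (negbTE xA).
Qed.

Lemma partition_remove Q A P : partition Q A -> P \in set0 |: Q ->
  partition (Q :\ P) (A :\: P).
Proof.
move=> QA; rewrite in_setU1 => /orP[/eqP->|PQ]; last exact: partitionD1.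
by have [_ _ Q0] := and3P QA; rewrite setD0 setD1_id.
Qed.

(** Puts [a] into the block [P] of [Q]; for [P = set0] this creates the new block
[[set a]], because then [Q :\ P = Q].  Both ways of extending a partition are
thus covered by letting [P] range over [set0 |: Q]. *)
Definition insert_block (a : T) Q P := (a |: P) |: (Q :\ P).

(** The inverse of [insert_block a]: what remains of the block of [a] once [a] is
taken out is returned as second component, and discarded from the partition
when it is empty. *)
Definition delete_block (a : T) Q :=
  let P := pblock Q a :\ a in ((P |: (Q :\ pblock Q a)) :\ set0, P).

Lemma insert_blockK (a : T) A Q P : a \notin A -> partition Q A ->
  P \in set0 |: Q ->
  partition (insert_block a Q P) (a |: A) /\
  delete_block a (insert_block a Q P) = (Q, P).
Proof.
move=> aA QA PQ; have [/eqP cQ tQ Q0] := and3P QA.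
have PA : P \subset A.
  case/setU1P: PQ => [->|PQ]; first exact: sub0set.
  by rewrite -cQ; apply: bigcup_sup PQ.
have aP : a \notin P by apply: contraNN aA => /(subsetP PA).
have Qa B : B \in Q -> a \notin B.
  by move=> BQ; apply: contraNN aA => aB; rewrite -cQ; apply/bigcupP; exists B.
have iQ : partition (insert_block a Q P) (a |: A).
  have -> : a |: A = (a |: P) :|: (A :\: P).
    by rewrite -finset.setUA -[in LHS](setID A P) (setIidPr PA).
  apply: partitionU1; first exact: partition_remove.
    by apply/set0Pn; exists a; rewrite setU11.
  rewrite -setI_eq0 -subset0; apply/subsetP => y.
  rewrite !inE => /andP[/orP[/eqP->|yP] /andP[yP' yA]].
    by rewrite yA in aA.
  by rewrite yP in yP'.
split=> //; rewrite /delete_block.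
have -> : pblock (insert_block a Q P) a = a |: P.
  by apply: def_pblock; rewrite ?setU11//; case/and3P: iQ.
rewrite setU1K//; congr (_, _).
have -> : insert_block a Q P :\ (a |: P) = Q :\ P.
  rewrite setU1K// !inE negb_and; apply/orP; right.
  by apply/negP => /Qa; rewrite setU11.
case/setU1P: PQ => [->|PQ]; first by rewrite setU1K ?setD11// setD1_id.
by rewrite setD1K// setD1_id.
Qed.

Lemma delete_blockK (a : T) A Q : a \notin A ->
  partition Q (a |: A) ->
  [/\ partition (delete_block a Q).1 A,
      (delete_block a Q).2 \in set0 |: (delete_block a Q).1 &
      insert_block a (delete_block a Q).1 (delete_block a Q).2 = Q].
Proof.
move=> aA QA; have [/eqP cQ tQ Q0] := and3P QA.
have aQ : a \in cover Q by rewrite cQ setU11.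
rewrite /delete_block /=; set B := pblock Q a; set P := B :\ a.
have BQ : B \in Q by exact: pblock_mem.
have aB : a \in B by rewrite mem_pblock.
have BA : B \subset a |: A by rewrite -cQ; apply: bigcup_sup BQ.
have QB := partitionD1 QA BQ.
have BP : a |: P = B by rewrite setD1K.
have PQB : P \notin Q :\ B.
  rewrite !inE; apply/negP => /andP[PB PQ].
  have /disjoint_setI0 := trivIsetP tQ _ _ PQ BQ PB.
  by rewrite (setIidPl (subD1set B a)) => P0; rewrite -P0 PQ in Q0.
have AE : P :|: ((a |: A) :\: B) = A.
  apply/setP => y; rewrite !in_setU in_setD in_setD1 in_setU1.
  have [->|ya] := eqVneq y a; first by rewrite aB (negbTE aA).
  case yB : (y \in B) => //=.
  by have := subsetP BA y yB; rewrite in_setU1 (negbTE ya) /= => ->.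
clearbody P; have [P0|P0] := eqVneq P set0.
  have QE : (P |: (Q :\ B)) :\ set0 = Q :\ B by rewrite P0 setU1K// -P0.
  rewrite QE; split.
  - by move: AE QB; rewrite P0 set0U => ->.
  - by rewrite P0 setU11.
  - by rewrite /insert_block BP setD1_id// setD1K.
have QE : (P |: (Q :\ B)) :\ set0 = P |: (Q :\ B).
  by rewrite setD1_id// !inE negb_or eq_sym P0 negb_and Q0 orbT.
rewrite QE; split.
- rewrite -[X in partition _ X]AE; apply: partitionU1 => //.
  rewrite -setI_eq0 -subset0; apply/subsetP => y.
  by rewrite in_setI in_setD -BP in_setU1 => /andP[->]; rewrite orbT.
- by rewrite setU1r// setU11.
- by rewrite /insert_block BP setU1K// setD1K.
Qed.

Lemma big_partitionU1 (U : nmodType) (a : T) A (F : {set {set T}} -> U) :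
  a \notin A ->
  (\sum_(Q | partition Q (a |: A)) F Q =
   \sum_(Q | partition Q A) \sum_(P in set0 |: Q)
     F (insert_block a Q P))%R.
Proof.
move=> aA; rewrite pair_big_dep /=.
rewrite (reindex_onto (fun p => insert_block a p.1 p.2) (delete_block a)) /=.
  apply: eq_bigl => -[Q P] /=; apply/idP/idP => [/andP[QA /eqP e]|/andP[QA PQ]].
    by have [] := delete_blockK aA QA; rewrite e => /= -> ->.
  by have [-> ->] := insert_blockK aA QA PQ; rewrite eqxx.
by move=> Q QA; have [] := delete_blockK aA QA.
Qed.
End Partitions.

(** * The formula *)

Lemma is_diff_sum (R : realType) (k : scalar_kind)
    (E F : normedModType (scalars R k)) (I : Type) (r : seq I) (p : pred I)
    (g dg : I -> E -> F) x :
  (forall i, p i -> is_diff x (g i) (dg i)) ->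
  is_diff x (fun y => \sum_(i <- r | p i) g i y)
    (fun h => \sum_(i <- r | p i) dg i h).
Proof.
move=> Dg; elim: r => [|i r IH].
  have -> : (fun y => \sum_(i <- [::] | p i) g i y) = cst 0.
    by apply/funext => y; rewrite big_nil.
  apply: is_diff_eq (is_diff_cst 0 x) _.
  by apply/funext => y; rewrite big_nil.
have -> : (fun y => \sum_(j <- i :: r | p j) g j y) =
    if p i then g i + (fun y => \sum_(j <- r | p j) g j y)
    else (fun y => \sum_(j <- r | p j) g j y).
  by apply/funext => y; rewrite big_cons; case: (p i).
have -> : (fun y => \sum_(j <- i :: r | p j) dg j y) =
    if p i then dg i + (fun y => \sum_(j <- r | p j) dg j y)
    else (fun y => \sum_(j <- r | p j) dg j y).
  by apply/funext => y; rewrite big_cons; case: (p i).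
by have := Dg i; case: (p i) => // /(_ isT) Di; exact: is_diffD.
Qed.

Section FaaDiBruno.
Import mathcomp.boot.fintype mathcomp.boot.finset.
Local Open Scope set_scope.
Local Open Scope ring_scope.
Variables (R : realType) (k : scalar_kind).
Local Notation K := (scalars R k).

Lemma is_diff_mderiv (T : eqType) (X E F : normedModType K) (l : seq T)
    (f : E -> F) (phi dphi : X -> E) (w dw : T -> X -> E) x :
  uniq l -> is_diff x phi dphi -> ndifferentiable (size l).+1 f (phi x) ->
  (forall i, i \in l -> is_diff x (w i) (dw i)) ->
  is_diff x (fun y => mderiv f (phi y) [seq w i y | i <- l])
    (fun h => mderiv f (phi x) (dphi h :: [seq w i x | i <- l]) +
      \sum_(i <- l)
        mderiv f (phi x) [seq if j == i then dw j h else w j x | j <- l]).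
Proof.
move=> ul Dphi nf Dw.
have Df := is_diff_deriv_blin (differentiable_nderiv (leqnn _) nf).
have := is_diff_meval ul (is_diff_comp Dphi Df) Dw.
have -> : (fun y => mderiv f (phi y) [seq w i y | i <- l]) =
    (fun y => meval ((nderiv (size l) f \o phi) y) [seq w i y | i <- l]).
  by apply/funext => y; apply: mderivE; rewrite size_map.
move/is_diff_eq; apply; apply/funext => h; congr (_ + _).
  by rewrite (mderivE _ _ (n := (size l).+1))//= size_map.
by apply: eq_bigr => i _; rewrite -mderivE// size_map.
Qed.

Lemma enum_setU1 (T : finType) (a : T) (A : {set T}) :
  a \notin A -> perm_eq (enum (a |: A)) (a :: enum A).
Proof.
move=> aA; apply: uniq_perm; rewrite /= ?mem_enum ?aA ?enum_uniq//.
by move=> y; rewrite inE !mem_enum in_setU1.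
Qed.

(** Bounds the order of the derivative of [f] that belongs to a partition. *)
Lemma leq_card_partition (T : finType) (Q : {set {set T}}) (A : {set T}) :
  partition Q A -> (#|Q| <= #|A|)%N.
Proof.
move=> QA; rewrite (card_partition QA) -sum1_card; apply: leq_sum => P PQ.
rewrite card_gt0; apply: contraTneq QA => P0.
by rewrite /partition -P0 PQ !andbF.
Qed.

Variables (T : finType) (X Y V : normedModType K) (phi : X -> Y) (f : Y -> V).
Variable v : T -> X.
Implicit Types (P : {set T}) (Q : {set {set T}}).

Let block x P := mderiv phi x [seq v i | i <- enum P].
Let term x Q := mderiv f (phi x) [seq block x P | P : {set T} <- enum Q].

Lemma block_insert x a P : a \notin P -> ndifferentiable #|P|.+1 phi x ->
  block x (a |: P) = mderiv phi x (v a :: [seq v i | i <- enum P]).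
Proof.
move=> aP nphi; apply: (mderiv_perm (perm_map v (enum_setU1 aP))).
by rewrite size_map -cardE cardsU1 aP.
Qed.

Lemma term_insert x a (A : {set T}) Q P : a \notin A -> partition Q A ->
  P \in set0 |: Q ->
  ndifferentiable #|A|.+1 phi x -> ndifferentiable #|A|.+1 f (phi x) ->
  term x (insert_block a Q P) =
  mderiv f (phi x) (mderiv phi x (v a :: [seq v i | i <- enum P]) ::
    [seq block x B | B : {set T} <- enum (Q :\ P)]).
Proof.
move=> aA QA PQ nphi nf.
have [iQ _] := insert_blockK aA QA PQ.
have [/eqP cQ _ _] := and3P QA.
have PA : P \subset A.
  case/setU1P: PQ => [->|PQ]; first exact: sub0set.
  by rewrite -cQ; apply: bigcup_sup PQ.
have aP : a \notin P by apply: contraNN aA => /(subsetP PA).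
have aQ : a |: P \notin Q :\ P.
  apply: contraNN aA; rewrite in_setD1 => /andP[_ aPQ].
  by rewrite -cQ; apply/bigcupP; exists (a |: P) => //; rewrite setU11.
rewrite -block_insert//; last first.
  by apply: ndifferentiable_le nphi; rewrite ltnS subset_leq_card.
apply: (mderiv_perm (perm_map (block x) (enum_setU1 aQ))).
rewrite size_map -cardE; apply: ndifferentiable_le nf.
by rewrite (leq_trans (leq_card_partition iQ))// cardsU1 aA.
Qed.

(** The derivative of one term of the formula in a new direction.  The summand
[P = set0] comes from differentiating the derivative of [f], the others from
differentiating the factor of the block [P]. *)
Lemma is_diff_term x a (A : {set T}) Q : a \notin A -> partition Q A ->
  ndifferentiable #|A|.+1 phi x -> ndifferentiable #|A|.+1 f (phi x) ->
  exists2 d, is_diff x (term^~ Q) d &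
    d (v a) = \sum_(P in set0 |: Q) term x (insert_block a Q P).
Proof.
move=> aA QA nphi nf.
have Dphi := is_diff_deriv_blin (ndifferentiable_differentiable nphi).
have [_ _ Q0] := and3P QA.
have PA P : P \in Q -> P \subset A.
  by move=> PQ; have [/eqP <- _ _] := and3P QA; apply: bigcup_sup PQ.
have nfQ : ndifferentiable (size (enum Q)).+1 f (phi x).
  by apply: ndifferentiable_le nf; rewrite ltnS -cardE leq_card_partition.
have Db P : P \in enum Q -> is_diff x (block^~ P)
    (fun h => mderiv phi x (h :: [seq v i | i <- enum P])).
  rewrite mem_enum => PQ; apply: is_diff_mderiv_cst.
  apply: ndifferentiable_le nphi.
  by rewrite size_map -cardE ltnS subset_leq_card// PA.
eexists; first exact: (is_diff_mderiv (enum_uniq Q) Dphi nfQ Db).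
rewrite /= big_setU1//=; congr (_ + _).
  rewrite (term_insert aA QA)//; last by rewrite setU11.
  by rewrite setD1_id// enum_set0.
rewrite big_enum /=; apply: eq_bigr => P PQ.
rewrite (term_insert aA QA)//; last by rewrite setU1r.
have eQ : perm_eq (enum Q) (P :: enum (Q :\ P)).
  by rewrite -[in X in perm_eq X _](setD1K PQ) enum_setU1// setD11.
set g := fun B => if B == P then _ else _.
rewrite (mderiv_perm (perm_map g eQ)); last first.
  by rewrite size_map; apply: ndifferentiable_le nfQ.
rewrite /= {1}/g eqxx; congr (mderiv _ _ (_ :: _)).
apply/eq_in_map => B; rewrite mem_enum in_setD1 => /andP[BP _].
by rewrite /g (negbTE BP).
Qed.

(** The formula for an arbitrary duplicate-free list of directions; such lists
are closed under taking tails, which makes the induction possible. *)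
Lemma mderiv_comp (s : seq T) x : uniq s ->
  ndifferentiable (size s) phi x -> ndifferentiable (size s) f (phi x) ->
  mderiv (f \o phi) x [seq v i | i <- s] =
  \sum_(Q | partition Q [set i in s]) term x Q.
Proof.
elim: s x => [|a s IH] x.
  move=> _ _ _; rewrite set_nil (big_pred1 set0) => [|Q]; last first.
    by rewrite partition_set0.
  by rewrite /term enum_set0.
move=> /= /andP[a_s us] nphi nf.
have [ngphi _] := nphi; have [ngf _] := nf.
have dphi := ndifferentiable_differentiable nphi.
have ngf' : \forall y \near x, ndifferentiable (size s) f (phi y).
  have cphi : {for x, continuous phi} by exact: differentiable_continuous.
  exact: (cphi _ ngf).
have nE : \forall y \near x, mderiv (f \o phi) y [seq v i | i <- s] =
    \sum_(Q | partition Q [set i in s]) term y Q.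
  by apply: filterS2 ngphi ngf' => y; exact: IH.
have cs : #|[set i in s]| = size s by rewrite cardsE (card_uniqP us).
have aA : a \notin [set i in s] by rewrite inE.
have nphiA : ndifferentiable #|[set i in s]|.+1 phi x by rewrite cs.
have nfA : ndifferentiable #|[set i in s]|.+1 f (phi x) by rewrite cs.
pose d Q := if pselect (partition Q [set i in s]) is left QA
  then s2val (cid2 (is_diff_term aA QA nphiA nfA))
  else cst 0.
have Dd Q : partition Q [set i in s] -> is_diff x (term^~ Q) (d Q).
  by rewrite /d => QA; case: pselect => // QA'; case: cid2.
have dE Q : partition Q [set i in s] ->
    d Q (v a) = \sum_(P in set0 |: Q) term x (insert_block a Q P).
  by rewrite /d => QA; case: pselect => // QA'; case: cid2.
have Dsum := is_diff_sum (index_enum _) Dd.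
have Dlhs : is_diff x (fun y => mderiv (f \o phi) y [seq v i | i <- s])
    (fun h => mderiv (f \o phi) x (h :: [seq v i | i <- s])).
  by apply: is_diff_mderiv_cst; rewrite size_map; exact: ndifferentiable_comp.
have := congr1 (@^~ (v a)) (is_diff_unique (near_eq_is_diff nE Dlhs) Dsum).
move=> /= ->; rewrite set_cons big_partitionU1//.
by apply: eq_bigr => Q; exact: dE.
Qed.

End FaaDiBruno.

Theorem proposition3p1 (R : realType) (k : scalar_kind)
  (X Y V : completeNormedModType (scalars R k))
  (Omega : set X) (hOmega : open Omega)
  (Omega' : set Y) (hOmega' : open Omega')
  (phi : X -> Y) (hphi : forall z : X, Omega z -> Omega' (phi z))
  (f : Y -> V) (m : nat) (hm : (1 <= m)%N) (x : X) (hx : Omega x)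
  (dphi : ndifferentiable m phi x) (df : ndifferentiable m f (phi x)) :
  ndifferentiable m (f \o phi) x /\
  forall (block_order : {set 'I_m} -> seq 'I_m)
    (parts_order : {set {set 'I_m}} -> seq {set 'I_m}),
  is_listing block_order -> is_listing parts_order ->
  forall v : 'I_m -> X,
    meval (nderiv m (f \o phi) x) [seq v i | i <- enum 'I_m] =
    \sum_(1 <= j < m.+1)
      \sum_(Q in set_partitions m j)
        meval (nderiv j f (phi x))
          [seq meval (nderiv #|P| phi x) [seq v i | i <- block_order P]
          | P : {set 'I_m} <- parts_order Q].
Proof.
split; first exact: ndifferentiable_comp.
move=> block_order parts_order block_perm parts_perm v.
(* The term of Q for the default enumerations of Q and of its blocks. *)
pose F (Q : {set {set 'I_m}}) := mderiv f (phi x)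
  [seq mderiv phi x [seq v i | i <- enum P] | P : {set 'I_m} <- enum Q].
have blockE (P : {set 'I_m}) :
    meval (nderiv #|P| phi x) [seq v i | i <- block_order P] =
    mderiv phi x [seq v i | i <- enum P].
  have bP := perm_map v (block_perm P).
  have cP : size [seq v i | i <- block_order P] = #|P|.
    by rewrite (perm_size bP) size_map -cardE.
  rewrite -mderivE//; apply: mderiv_perm => //.
  by apply: ndifferentiable_le dphi; rewrite cP -[leqRHS]card_ord max_card.
have termE j (Q : {set {set 'I_m}}) : Q \in set_partitions m j ->
    meval (nderiv j f (phi x))
      [seq meval (nderiv #|P| phi x) [seq v i | i <- block_order P]
      | P : {set 'I_m} <- parts_order Q] = F Q.
  rewrite inE => /andP[QT /eqP cQ].
  rewrite (eq_map blockE).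
  have pQ := perm_map (fun P : {set 'I_m} =>
    mderiv phi x [seq v i | i <- enum P]) (parts_perm Q).
  have sQ := perm_size pQ; rewrite [RHS]size_map -cardE cQ in sQ.
  rewrite -mderivE//; apply: mderiv_perm => //.
  apply: ndifferentiable_le df; rewrite sQ -cQ.
  by rewrite (leq_trans (leq_card_partition QT))// cardsT card_ord.
rewrite -(mderivE (f \o phi)); last by rewrite size_map size_enum_ord.
rewrite mderiv_comp ?size_enum_ord ?enum_uniq//.
have -> : [set i in enum 'I_m]%SET = [set: 'I_m]%SET.
  by apply/finset.setP => i; rewrite finset.in_set finset.in_setT mem_enum.
transitivity (\sum_(1 <= j < m.+1)
  \sum_(Q | finset.partition Q finset.setT && (#|Q| == j)) F Q); last first.
  apply: eq_bigr => j _; apply: eq_big => [Q|Q QP]; first by rewrite inE.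
  by rewrite termE// inE.
(* Grouping the partitions by their number of blocks: exactly one j fits Q. *)
rewrite (exchange_big_dep (fun Q => finset.partition Q finset.setT)) /=; last first.
  by move=> j Q _ /andP[].
apply: eq_bigr => Q QT; rewrite QT /=.
under eq_bigl do rewrite eq_sym.
rewrite big_nat1_eq ltnS.
have Qm : (#|Q| <= m)%N.
  by rewrite (leq_trans (leq_card_partition QT))// cardsT card_ord.
have Q1 : (0 < #|Q|)%N.
  rewrite card_gt0; apply: contraTneq QT => ->.
  apply/negP => /and3P[/eqP c _ _]; have := finset.in_setT (Ordinal hm).
  by rewrite -c /finset.cover big_set0 finset.in_set0.
by rewrite Q1 Qm.
Qed.
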